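(* Call a model $\mathfrak{M}=\langle W,\langle\mathcal{N}_i\rangle_{i\in I},V\rangle$ monotone iff for all $i\in I$ and all $w\in W$, $\mathcal{N}_i(w)$ is closed under supersets, i.e. for all $X\in\mathcal{N}_i(w)$ and all $Y\subseteq W$ with $X\subseteq Y$, also $Y\in\mathcal{N}_i(w)$. The logic of the class of all monotone models is axiomatized by adding to $\mathbf{B}$ all instances of the schema (RM$_G$): $\square_G\varphi\rightarrow\square_G(\varphi\vee\psi)$ ($G$ any group, $\varphi,\psi\in\mathfrak{L}$).
   Context: Fix a (finite or infinite) index set $I$ and a countable set $\mathfrak{P}$ of propositional variables. A group is a non-empty finite subset of $I$; $G,H,J$ always range over groups. Language: $\mathfrak{L}$ is generated from $\mathfrak{P}$ and the constants $\bot,\top$ by the classical connectives ($\bot,\neg,\vee$ primitive, the others and $\top$ defined as usual) and the unary modal operators $\square_G$, one for each group $G$. Write $\square_i$ for $\square_{\{i\}}$. Models: a model is $\mathfrak{M}=\langle W,\langle\mathcal{N}_i\rangle_{i\in I},V\rangle$ with $W\neq\emptyset$, $\mathcal{N}_i:W\to\wp(\wp(W))$ for each $i\in I$, and $V:\mathfrak{P}\to\wp(W)$. For a group $G=\{i_1,\ldots,i_n\}$, $\mathcal{N}_G(w)=\{X_{i_1}\cap\cdots\cap X_{i_n}\mid X_{i_j}\in\mathcal{N}_{i_j}(w)\text{ for each }j\}$. Truth at a world is defined as usual for variables and classical connectives, and $\mathfrak{M},w\models\square_G\varphi$ iff $\|\varphi\|^{\mathfrak{M}}\in\mathcal{N}_G(w)$,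 where $\|\varphi\|^{\mathfrak{M}}=\{w\in W\mid\mathfrak{M},w\models\varphi\}$. For a class of models, $\Gamma\Vdash\varphi$ means: at every world of every model in the class at which all members of $\Gamma$ are true, $\varphi$ is true. The base system $\mathbf{B}$ consists of any sound and complete axiomatization of classical propositional logic, all instances in $\mathfrak{L}$ of (B1) $(\square_G\varphi\wedge\square_H\psi)\rightarrow\square_{G\cup H}(\varphi\wedge\psi)$, where $G\cap H=\emptyset$; (B2) $\square_{G\cup H}\top\rightarrow\square_G\top$; (B3) $(\square_G\varphi\wedge\square_{G\cup H\cup J}\varphi)\rightarrow\square_{G\cup H}\varphi$; (B4) $(\square_G\varphi\wedge\square_H(\varphi\vee\psi))\rightarrow\square_{G\cup H}\varphi$; and the rules (RE) if $\varphi\vdash\psi$ and $\psi\vdash\varphi$, then $\square_G\varphi\vdash\square_G\psi$; (MP) if $\vdash\varphi$ and $\vdash\varphi\rightarrow\psi$, then $\vdash\psi$. Systems obtained by adding axioms keep both rules. A theorem of a system is a formula derivable from its axioms by the rules; $\Gamma\vdash\varphi$ iff there are $\psi_1,\ldots,\psi_n\in\Gamma$ ($n\ge 0$) such that $(\psi_1\wedge\cdots\wedge\psi_n)\rightarrow\varphi$ is a theorem. The logic of a class of models is axiomatized by a system if the system is sound and strongly complete for the class: for all $\Gamma\subseteq\mathfrak{L}$, $\varphi\in\mathfrak{L}$, $\Gamma\vdash\varphi$ iff $\Gamma\Vdash\varphi$ over the class. *)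

(* Defs.v *)
From mathcomp Require Import all_boot finmap.
From mathcomp Require Import boolp classical_sets.
From Stdlib Require List.

Set Implicit Arguments.
Unset Strict Implicit.
Unset Printing Implicit Defensive.

Local Open Scope classical_set_scope.

(* [choiceType] is no restriction on the index set: classically every type
   carries such a structure. It makes [{fset I}] extensional. *)
Record group (I : choiceType) := Group {
  gset :> {fset I};
  group_neq0 : gset != fset0
}.

Lemma groupU_neq0 (I : choiceType) (G H : group I) :
  (gset G `|` gset H)%fset != fset0.
Proof. by rewrite fsetU_eq0 negb_and group_neq0. Qed.

Definition groupU (I : choiceType) (G H : group I) : group I :=
  Group (groupU_neq0 G H).

Inductive formula (I : choiceType) (P : countType) : Type :=
  | Var of P
  | Bot
  | Neg of formula I P
  | Or of formula I P & formula I P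
  | Box of group I & formula I P.

Arguments Var {I P}.
Arguments Bot {I P}.

Section Connectives.
Context {I : choiceType} {P : countType}.
Implicit Types phi psi : formula I P.

Definition Top : formula I P := Neg Bot.
Definition And phi psi := Neg (Or (Neg phi) (Neg psi)).
Definition Imp phi psi := Or (Neg phi) psi.

End Connectives.

Section Semantics.
Context {I : choiceType} {P : countType}.

Record model := Model {
  world : Type;
  world_inhabited : inhabited world;
  nbhd : I -> world -> set (set world);
  valuation : P -> set world
}.

(* Only the values of [X] on [G] matter, so a choice of one neighbourhood for
   each member of [G] is given by a total function on [I]. *)
Definition group_nbhd (M : model) (G : group I) (w : world M) :
    set (set (world M)) :=
  [set \bigcap_(i in [set` gset G]) X i |
    X in [set X : I -> set (world M) | forall i, i \in gset G -> nbhd i w (X i)]].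

Fixpoint sat (M : model) (w : world M) (phi : formula I P) : Prop :=
  match phi with
  | Var p => valuation p w
  | Bot => False
  | Neg phi1 => ~ sat w phi1
  | Or phi1 phi2 => sat w phi1 \/ sat w phi2
  | Box G phi1 => group_nbhd G w [set v | sat v phi1]
  end.

(* Classes of models are predicates rather than elements of [set model], so as
   not to force [world] to live in a smaller universe than [set (formula I P)]. *)
Definition entails (C : model -> Prop) (Gamma : set (formula I P))
    (phi : formula I P) : Prop :=
  forall M : model, C M -> forall w : world M,
    (forall psi, Gamma psi -> sat w psi) -> sat w phi.

Definition monotone (M : model) : Prop :=
  forall (i : I) (w : world M) (X Y : set (world M)),
    nbhd i w X -> X `<=` Y -> nbhd i w Y.

End Semantics.

Arguments model : clear implicits.

Section Deduction.
Context {I : choiceType} {P : countType}.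
Implicit Types (phi psi : formula I P) (G H J : group I).
Implicit Types Ax Gamma A : set (formula I P).

(* Variables and boxed formulas are the propositional atoms: [v] is
   unconstrained on them. *)
Definition boolean_valuation (v : formula I P -> bool) : Prop :=
  [/\ v Bot = false,
      forall phi, v (Neg phi) = ~~ v phi
    & forall phi psi, v (Or phi psi) = v phi || v psi].

Definition tautology phi : Prop :=
  forall v, boolean_valuation v -> v phi = true.

Inductive mp_closure A : formula I P -> Prop :=
  | mp_closure_ax phi of A phi : mp_closure A phi
  | mp_closure_mp phi psi of mp_closure A phi & mp_closure A (Imp phi psi) :
      mp_closure A psi.

(* A sound and complete axiomatization (with modus ponens as rule) of classical
   propositional logic, over the modal language. *)
Definition cpl_axiomatization A : Prop :=
  forall phi, mp_closure A phi <-> tautology phi.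

Inductive B_schema : formula I P -> Prop :=
  | B1 G H phi psi of [disjoint gset G & gset H]%fset :
      B_schema (Imp (And (Box G phi) (Box H psi))
                    (Box (groupU G H) (And phi psi)))
  | B2 G H : B_schema (Imp (Box (groupU G H) Top) (Box G Top))
  | B3 G H J phi :
      B_schema (Imp (And (Box G phi) (Box (groupU (groupU G H) J) phi))
                    (Box (groupU G H) phi))
  | B4 G H phi psi :
      B_schema (Imp (And (Box G phi) (Box H (Or phi psi)))
                    (Box (groupU G H) phi)).

Definition system_B A : set (formula I P) := A `|` B_schema.

Definition RM_schema : set (formula I P) :=
  [set chi | exists G phi psi, chi = Imp (Box G phi) (Box G (Or phi psi))].

(* In [theorem_RE], [phi |- psi] between single formulas is the theoremhood of
   [phi -> psi]. *)
Inductive theorem_of Ax : formula I P -> Prop :=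
  | theorem_ax phi of Ax phi : theorem_of Ax phi
  | theorem_RE G phi psi of
      theorem_of Ax (Imp phi psi) & theorem_of Ax (Imp psi phi) :
      theorem_of Ax (Imp (Box G phi) (Box G psi))
  | theorem_MP phi psi of theorem_of Ax phi & theorem_of Ax (Imp phi psi) :
      theorem_of Ax psi.

Definition derives Ax Gamma phi : Prop :=
  exists2 s : seq (formula I P),
    List.Forall Gamma s & theorem_of Ax (Imp (foldr And Top s) phi).

Definition axiomatized_by (C : model I P -> Prop) Ax : Prop :=
  forall Gamma phi, derives Ax Gamma phi <-> entails C Gamma phi.

End Deduction.

(* Main.v *)
Require Import Defs.
From mathcomp Require Import all_boot finmap.
From mathcomp Require Import boolp classical_sets.
From Stdlib Require List.
Local Open Scope classical_set_scope.

Set Implicit Arguments.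
Unset Strict Implicit.

(** Soundness is a computation with families of neighbourhoods.  Strong
    completeness rests on a canonical model whose worlds are pairs of a maximal
    consistent set, presented as a Boolean valuation [v] making all theorems
    true (a [state]), and a function [f] (a [dissent]) that picks, for every
    index [(G, phi)], one member of [G].

    The difficulty is that [Box G phi] in [v] requires neighbourhoods [X i],
    for [i] in [G], that intersect to exactly the truth set of [phi], while no
    proper subfamily, and no mixture with neighbourhoods stemming from other
    boxes, may intersect to anything that the logic does not force.  The second
    component of the worlds provides this independence: [share i (G, phi)]
    contains a world iff [phi] holds there or its function does not pick [i]
    for [(G, phi)].  Since exactly one member of [G] is picked, the shares of
    all members of [G] intersect to the truth set of [phi]; but as soon as some
    member is left out, it can be the one picked, at every state.  The
    neighbourhoods of [i] at [(v, f)] are the supersets of the shares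
    [share i (G, phi)] with [i] in [G] and [Box G phi] in [v], so that the
    model is monotone.

    For the truth lemma, let members [i] of [G] contribute shares for indices
    [c i], and let those shares intersect to a subset of the truth set of
    [phi].  The fibres of [c] partition [G].  If the fibre of [(H, psi)] is all
    of [H], its shares together say [psi], and [Box H psi] is in [v];
    otherwise they can be made to say nothing, and (RM) and (B2) yield
    [Box K Top] for the fibre [K], as [K] is a subset of [H].  Since fibres are
    disjoint, (B1) combines these boxes into [Box G chi], where [chi] is the
    conjunction of the [psi] of the fibres of the first kind
    ([truth_Box_combine]).
    Every state in which [chi] holds is the first component of a world in all
    contributed shares, hence [chi] provably implies [phi], and (RM) gives
    [Box G phi] ([truth_Box_share]). *)

(** * Groups *)

Lemma group_inj (I : choiceType) (G H : group I) : gset G = gset H -> G = H.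
Proof.
case: G H => [G G0] [H H0] /= eGH; case: _ / eGH H0 => H0.
by rewrite (eq_irrelevance G0 H0).
Qed.

Lemma group_inhabited (I : choiceType) (G : group I) : exists i, i \in gset G.
Proof. exact/fset0Pn/group_neq0. Qed.

(** * Soundness *)

Section Soundness.
Context {I : choiceType} {P : countType}.
Implicit Types (phi psi : formula I P) (G H : group I).

Lemma sat_Imp (M : model I P) (w : world M) phi psi :
  sat w (Imp phi psi) <-> (sat w phi -> sat w psi).
Proof.
split=> [[nphi|//] /nphi //|h] /=.
by case: (pselect (sat w phi)) => [/h|]; [right|left].
Qed.

Lemma sat_And (M : model I P) (w : world M) phi psi :
  sat w (And phi psi) <-> sat w phi /\ sat w psi.
Proof. by rewrite /= not_orP !notK. Qed.

Lemma sat_Box (M : model I P) (w : world M) G phi :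
  sat w (Box G phi) <->
  exists2 X : I -> set (world M), (forall i, i \in gset G -> nbhd i w (X i)) &
    forall v, sat v phi <-> forall i, i \in gset G -> X i v.
Proof.
split=> [[X hX eX]|[X hX eX]]; exists X => //.
  by move=> v; rewrite -[sat v phi]/([set u | sat u phi] v) -eX.
by apply/seteqP; split=> v /= /eX.
Qed.

Lemma tautology_sat (M : model I P) (w : world M) phi :
  tautology phi -> sat w phi.
Proof.
move=> taut; apply/asboolP/(taut (fun psi => `[< sat w psi >])).
split=> [|psi|psi chi] /=.
- by apply/asboolP.
- exact: asbool_neg.
- exact: asbool_or.
Qed.

(** The members of [G] keep their own neighbourhood, whatever they contribute
    to [H]; this is the common reason for (B1), (B3) and (B4). *)
Lemma sat_Box_pool (M : model I P) (w : world M) G H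
    (X Y : I -> set (world M)) phi :
    (forall i, i \in gset G -> nbhd i w (X i)) ->
    (forall i, i \in gset H -> i \notin gset G -> nbhd i w (Y i)) ->
    (forall v, sat v phi <->
       (forall i, i \in gset G -> X i v) /\
       (forall i, i \in gset H -> i \notin gset G -> Y i v)) ->
  sat w (Box (groupU G H) phi).
Proof.
move=> hX hY hphi; apply/sat_Box.
exists (fun i => if i \in gset G then X i else Y i) => [i|v].
  by rewrite inE; case: ifPn => [/hX //|nG] /= iH; apply: hY.
rewrite hphi; split=> [[Xv Yv] i|XY].
  by rewrite inE; case: ifPn => [/Xv //|nG] /= iH; apply: Yv.
split=> [i iG|i iH nG].
  by have := XY i; rewrite inE iG; apply.
by have := XY i; rewrite inE iH (negbTE nG); apply.
Qed.

Lemma B_schema_sound (M : model I P) (w : world M) phi :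
  B_schema phi -> sat w phi.
Proof.
case=> {phi} [G H phi psi dGH|G H|G H J phi|G H phi psi]; apply/sat_Imp.
- move=> /sat_And[/sat_Box[X hX eX] /sat_Box[Y hY eY]].
  apply: (sat_Box_pool hX (Y := Y)) => [i iH _|v]; first exact: hY.
  rewrite sat_And eX eY; split=> -[Xv Yv]; split=> // i iH.
    by move=> _; apply: Yv.
  by apply: Yv => //; move: dGH; rewrite fdisjoint_sym => /fdisjointP; apply.
- move=> /sat_Box[X hX eX]; apply/sat_Box; exists X => [i iG|v].
    by apply: hX; rewrite inE iG.
  split=> [_ i iG|_ []].
  by apply: ((eX v).1 id i); rewrite inE iG.
- move=> /sat_And[/sat_Box[X hX eX] /sat_Box[Y hY eY]].
  apply: (sat_Box_pool hX (Y := Y)) => [i iH _|v].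
    by apply: hY; rewrite !inE iH orbT.
  rewrite -eX; split=> [phiv|[]//]; split=> // i iH _.
  by apply: (proj1 (eY v)) => //; rewrite !inE iH orbT.
- move=> /sat_And[/sat_Box[X hX eX] /sat_Box[Y hY eY]].
  apply: (sat_Box_pool hX (Y := Y)) => [i iH _|v]; first exact: hY.
  rewrite -eX; split=> [phiv|[]//]; split=> // i iH _.
  by apply: (proj1 (eY v)) => //; left.
Qed.

(** Enlarging every contribution [X i] by the truth set of the weaker formula
    enlarges their intersection to exactly that truth set. *)
Lemma RM_schema_sound (M : model I P) (w : world M) phi :
  monotone M -> RM_schema phi -> sat w phi.
Proof.
move=> monM [G [phi1 [psi ->]]]; apply/sat_Imp => /sat_Box[X hX eX].
apply/sat_Box; exists (fun i => X i `|` [set v | sat v (Or phi1 psi)]).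
  by move=> i iG; apply: monM (hX i iG) _ => v; left.
move=> v; split=> [h i _|h]; first by right.
apply: contrapT => nor; apply: (nor); left; apply/eX => i iG.
by case: (h i iG).
Qed.

Lemma theorem_of_sound (A : set (formula I P)) (hA : cpl_axiomatization A)
    (M : model I P) (monM : monotone M) phi :
  theorem_of (system_B A `|` RM_schema) phi -> forall w : world M, sat w phi.
Proof.
elim=> {phi} [phi Axphi|G phi psi _ IH1 _ IH2|phi psi _ IH1 _ IH2] w.
- case: Axphi => [[Aphi|Bphi]|RMphi].
  + by apply/tautology_sat/hA/mp_closure_ax.
  + exact: B_schema_sound.
  + exact: RM_schema_sound.
- apply/sat_Imp => /sat_Box[X hX eX]; apply/sat_Box; exists X => // v.
  by rewrite -eX; split; apply/sat_Imp.
- by move/sat_Imp: (IH2 w); apply.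
Qed.

Lemma derives_sound (A : set (formula I P)) (hA : cpl_axiomatization A)
    Gamma phi :
  derives (system_B A `|` RM_schema) Gamma phi ->
  entails (@monotone I P) Gamma phi.
Proof.
move=> [s sGamma /(theorem_of_sound hA) thm] M monM w wGamma.
have /sat_Imp := thm M monM w; apply.
elim: {thm} sGamma => [[]|psi t Gpsi _ IH].
by apply/sat_And; split=> //; apply: wGamma.
Qed.

End Soundness.

(** * Extending consistent sets to maximal ones *)

(** The characteristic functions of the maximal consistent sets. *)
Record state (I : choiceType) (P : countType) (Ax : set (formula I P)) :=
    State {
  truth :> formula I P -> bool;
  truth_boolean : boolean_valuation truth;
  truth_theorem : forall phi, theorem_of Ax phi -> truth phi
}.

Section Lindenbaum.
(* Propositional reasoning goes through Boolean valuations: an entailment that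
   holds under all of them is available to every system that proves the
   tautologies. *)
Context {I : choiceType} {P : countType}.
Implicit Types (phi psi chi : formula I P) (v : formula I P -> bool).

Lemma valuation_Top v : boolean_valuation v -> v Top.
Proof. by case=> vB vN _; rewrite /Top vN vB. Qed.

Lemma valuation_Imp v phi psi :
  boolean_valuation v -> v (Imp phi psi) = (v phi ==> v psi).
Proof. by case=> _ vN vO; rewrite /Imp vO vN implybE. Qed.

Lemma valuation_And v phi psi :
  boolean_valuation v -> v (And phi psi) = v phi && v psi.
Proof. by case=> _ vN vO; rewrite /And vN vO !vN negb_or !negbK. Qed.

Lemma valuation_foldr v s :
  boolean_valuation v -> v (foldr And Top s) = all v s.
Proof.
move=> bv; elim: s => [|psi s IH] /=; first exact: valuation_Top.
by rewrite valuation_And // IH.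
Qed.

Context {Ax : set (formula I P)}.
Hypothesis tautology_theorem : forall phi, tautology phi -> theorem_of Ax phi.

Lemma theorem_consequence phi psi :
    (forall v, boolean_valuation v -> v phi -> v psi) ->
  theorem_of Ax phi -> theorem_of Ax psi.
Proof.
move=> h thm; apply: (theorem_MP thm); apply: tautology_theorem => v bv.
by rewrite valuation_Imp //; apply/implyP/h.
Qed.

Lemma theorem_consequence2 phi psi chi :
    (forall v, boolean_valuation v -> v phi -> v psi -> v chi) ->
  theorem_of Ax phi -> theorem_of Ax psi -> theorem_of Ax chi.
Proof.
move=> h thm1 thm2; apply: (theorem_MP thm2).
apply: theorem_consequence thm1 => v bv vphi.
by rewrite valuation_Imp //; apply/implyP/h.
Qed.

Lemma theorem_derives Gamma phi : theorem_of Ax phi -> derives Ax Gamma phi.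
Proof.
move=> thm; exists [::]; first exact: List.Forall_nil.
apply: theorem_consequence thm => v bv vphi.
by rewrite valuation_Imp // vphi implybT.
Qed.

Lemma derives_mem Gamma phi : Gamma phi -> derives Ax Gamma phi.
Proof.
move=> Gphi; exists [:: phi].
  by apply: List.Forall_cons => //; apply: List.Forall_nil.
apply: tautology_theorem => v bv.
by rewrite valuation_Imp // valuation_foldr //= andbT implybb.
Qed.

Lemma derives_consequence2 Gamma phi psi chi :
    (forall v, boolean_valuation v -> v phi -> v psi -> v chi) ->
  derives Ax Gamma phi -> derives Ax Gamma psi -> derives Ax Gamma chi.
Proof.
move=> h [s sG thm1] [t tG thm2]; exists (s ++ t).
  exact/List.Forall_app.
apply: theorem_consequence2 thm1 thm2 => v bv.
rewrite !valuation_Imp // !valuation_foldr // all_cat.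
by move=> /implyP h1 /implyP h2; apply/implyP => /andP[/h1 h1s /h2]; apply: h.
Qed.

Lemma derives_deduction Gamma phi psi :
  derives Ax (Gamma `|` [set phi]) psi -> derives Ax Gamma (Imp phi psi).
Proof.
move=> [s sG thm].
have [t tG hst] : exists2 t, List.Forall Gamma t &
    forall v, v phi -> all v t -> all v s.
  elim: sG => {thm} [|chi r [Gchi|->] _ [t tG hst]]; first by exists [::].
  - exists (chi :: t) => [|v vphi /= /andP[-> vt]]; last exact: hst.
    exact: List.Forall_cons.
  - by exists t => // v vphi vt; rewrite /= vphi hst.
exists t => //; apply: theorem_consequence thm => v bv.
rewrite !valuation_Imp // !valuation_foldr // => /implyP vs.
by apply/implyP => vt; apply/implyP => vphi; apply/vs/hst.
Qed.

(** Only finitely many premises are used, and in a chain of sets they all lie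
    in one member. The first alternative covers the empty chain. *)
Lemma derives_bigcup (F : set (set (formula I P))) Gamma phi :
    total_on F subset -> derives Ax (Gamma `|` \bigcup_(X in F) X) phi ->
  derives Ax Gamma phi \/ exists2 X, F X & derives Ax (Gamma `|` X) phi.
Proof.
move=> totF [s sG thm].
have [sG'|[X FX sX]] : List.Forall Gamma s \/
    exists2 X, F X & List.Forall (Gamma `|` X) s; last first.
- by right; exists X => //; exists s.
- by left; exists s.
elim: sG => {thm} [|psi r Gpsi _ IH]; first by left; apply: List.Forall_nil.
case: Gpsi IH => [Gpsi|[Y FY Ypsi]] [rG|[X FX rX]].
- by left; apply: List.Forall_cons.
- by right; exists X => //; apply: List.Forall_cons => //; left.
- right; exists Y => //; apply: List.Forall_cons; first by right.
  by apply: List.Forall_impl rG => chi Gchi; left.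
- case: (totF X Y FX FY) => XY; right; [exists Y|exists X] => //.
    apply: List.Forall_cons; first by right.
    by apply: List.Forall_impl rX => chi [Gchi|Xchi]; [left|right; apply: XY].
  by apply: List.Forall_cons => //; right; apply: XY.
Qed.

(** Zorn's lemma gives a largest extension [D] of [Gamma] that does not derive
    [phi]. By maximality [D] derives [Imp psi phi] whenever it does not derive
    [psi]; this makes derivability from [D] commute with the connectives. *)
Lemma lindenbaum Gamma phi : ~ derives Ax Gamma phi ->
  exists v : state Ax, (forall psi, Gamma psi -> v psi) /\ ~~ v phi.
Proof.
move=> nder.
(* The sets added to [Gamma], rather than the supersets of [Gamma], are
   ordered, so that the union of the empty chain is admissible. *)
have [|X [nX maxX]] := @Zorn_bigcup _ [set X | ~ derives Ax (Gamma `|` X) phi].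
  move=> F FP totF /(derives_bigcup totF)[//|[X /FP]]; exact.
pose D := Gamma `|` X.
have refutes psi : ~ derives Ax D psi -> derives Ax D (Imp psi phi).
  move=> nDpsi; apply: derives_deduction => //; rewrite /D -setUA.
  apply: contrapT; apply: maxX; split; first by move=> chi; left.
  move=> /(_ psi (or_intror erefl)) Xpsi.
  by apply/nDpsi/derives_mem => //; right.
have boolD : boolean_valuation (fun psi => `[< derives Ax D psi >]).
  split=> [|psi|psi chi].
  - apply/asboolP => dB; apply: nX.
    by apply: (derives_consequence2 _ dB dB) => // v [->].
  - rewrite -asbool_neg; apply: asbool_equiv_eq; split=> [dN dpsi|/refutes di].
      apply: nX; apply: (derives_consequence2 _ dN dpsi) => // v [_ -> _].
      by move=> /negP.
    apply: contrapT => /refutes dni; apply: nX.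
    apply: (derives_consequence2 _ di dni) => // v bv.
    rewrite !valuation_Imp //; case: bv => _ -> _.
    by case: (v psi).
  - rewrite -asbool_or; apply: asbool_equiv_eq; split=> [dO|[] d]; last first.
    + by apply: (derives_consequence2 _ d d) => // v [_ _ ->] ->; rewrite orbT.
    + by apply: (derives_consequence2 _ d d) => // v [_ _ ->] ->.
    apply: contrapT => /not_orP[/refutes d1 /refutes d2]; apply: nX.
    have d : derives Ax D (Imp (Or psi chi) phi).
      apply: (derives_consequence2 _ d1 d2) => // v bv.
      rewrite !valuation_Imp //; case: bv => _ _ ->.
      by case: (v psi).
    apply: (derives_consequence2 _ d dO) => // v bv.
    by rewrite valuation_Imp // => /implyP; apply.
have thmD psi : theorem_of Ax psi -> `[< derives Ax D psi >].
  by move=> thm; apply/asboolP/theorem_derives.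
exists (State boolD thmD); split=> [psi Gpsi|]; last exact/asboolPn.
by apply/asboolP/derives_mem => //; left.
Qed.

Lemma truth_Imp (v : state Ax) phi psi : v (Imp phi psi) -> v phi -> v psi.
Proof. by rewrite (valuation_Imp _ _ (truth_boolean v)) => /implyP. Qed.

Lemma truth_And (v : state Ax) phi psi : v (And phi psi) = v phi && v psi.
Proof. exact: valuation_And (truth_boolean v). Qed.

Lemma truth_Top (v : state Ax) : v Top.
Proof. exact: valuation_Top (truth_boolean v). Qed.

Lemma truth_Neg (v : state Ax) phi : v (Neg phi) = ~~ v phi.
Proof. by case: (truth_boolean v). Qed.

Lemma truth_Or (v : state Ax) phi psi : v (Or phi psi) = v phi || v psi.
Proof. by case: (truth_boolean v). Qed.

Lemma state_theorem phi psi :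
  (forall v : state Ax, v phi -> v psi) -> theorem_of Ax (Imp phi psi).
Proof.
move=> h; apply: contrapT => nthm.
have [|v [_]] := @lindenbaum set0 (Imp phi psi).
  move=> [s sG thm]; apply: nthm.
  (* A list of members of the empty set is empty. *)
  case: sG thm => [|? ? []] thm.
  apply: (theorem_MP _ thm); apply: tautology_theorem => v bv.
  exact: valuation_Top.
rewrite (valuation_Imp _ _ (truth_boolean v)) => /negP[].
exact/implyP/h.
Qed.

End Lindenbaum.

(** * The canonical model *)

Section Canonical.
Context {I : choiceType} {P : countType} {Ax : set (formula I P)}.
Hypothesis tautology_theorem : forall phi, tautology phi -> theorem_of Ax phi.
Hypothesis B_theorem : forall phi, B_schema phi -> theorem_of Ax phi.
Hypothesis RM_theorem : forall phi, RM_schema phi -> theorem_of Ax phi.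
Implicit Types (phi psi chi : formula I P) (G H K : group I) (v u : state Ax).

Notation box_index := (group I * formula I P)%type.

Lemma truth_Box_monotone v G phi psi :
    (forall u : state Ax, u phi -> u psi) ->
  v (Box G phi) -> v (Box G psi).
Proof.
move=> h vphi.
have RM : RM_schema (Imp (Box G phi) (Box G (Or phi psi))).
  by exists G, phi, psi.
have /(truth_Imp (truth_theorem v (RM_theorem RM))) := vphi.
apply: truth_Imp; apply: truth_theorem; apply: theorem_RE;
  apply: (state_theorem tautology_theorem) => u; rewrite truth_Or.
  by case/orP => // /h.
by move=> ->; rewrite orbT.
Qed.

Lemma truth_B1 v G H phi psi : [disjoint gset G & gset H]%fset ->
  v (Box G phi) -> v (Box H psi) -> v (Box (groupU G H) (And phi psi)).
Proof.
move=> dGH vG vH; apply: (truth_Imp (truth_theorem v (B_theorem (B1 _ _ dGH)))).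
by rewrite truth_And vG.
Qed.

Lemma truth_Box_subgroup v G H phi :
  (gset G `<=` gset H)%fset -> v (Box H phi) -> v (Box G Top).
Proof.
move=> sGH vH; apply: (truth_Imp (truth_theorem v (B_theorem (B2 G H)))).
have -> : groupU G H = H by apply: group_inj; apply/fsetUidPr.
by apply: truth_Box_monotone vH => u _; apply: truth_Top.
Qed.

(** When [c i] is the index to which [i] contributes, this says that all members
    of the group of [p] belong to [S] and contribute to [p]. *)
Definition exhausted (c : I -> box_index) (S : {fset I}) (p : box_index) :
    Prop :=
  forall j, j \in gset p.1 -> j \in S /\ c j = p.

(** The induction removes from [G] one fibre [K] of [c] at a time. A box for [K]
    is the given one if [K] exhausts its index, and [Box K Top] otherwise; it
    is joined by (B1) to the box for the rest of [G]. Exhausted indices of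
    other fibres stay exhausted in the rest, as fibres are disjoint. *)
Lemma truth_Box_combine v (c : I -> box_index) G :
    (forall i, i \in gset G -> i \in gset (c i).1 /\ v (Box (c i).1 (c i).2)) ->
  exists2 chi, v (Box G chi) &
    forall u, u chi -> forall i, i \in gset G ->
      exhausted c (gset G) (c i) -> u (c i).2.
Proof.
have [n] := ubnP #|` gset G|; elim: n G => // n IH G ltGn cG.
have [i iG] := group_inhabited G.
pose S := [fset j in gset G | `[< c j = c i >]]%fset.
have memS j : (j \in S) = (j \in gset G) && `[< c j = c i >] by rewrite !inE.
have iS : i \in S by rewrite memS iG; apply/asboolP.
have S0 : S != fset0 by apply/fset0Pn; exists i.
pose K := Defs.Group S0.
have [chiK vK hK] : exists2 chi, v (Box K chi) &
    forall u, u chi -> exhausted c (gset G) (c i) -> u (c i).2.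
  have sK : (S `<=` gset (c i).1)%fset.
    by apply/fsubsetP => j; rewrite memS => /andP[/cG[+ _] /asboolP <-].
  have [_ vi] := cG i iG.
  case: (pselect (exhausted c (gset G) (c i))) => [exh|nexh]; last first.
    by exists Top => //; apply: truth_Box_subgroup vi.
  exists (c i).2 => //; have -> // : K = (c i).1.
  apply: group_inj; apply/eqP; rewrite eqEfsubset sK.
  apply/fsubsetP => j /exh[jG cj].
  by rewrite memS jG; apply/asboolP.
have [GK0|GK0] := eqVneq (gset G `\` S)%fset fset0.
  have eGK : gset G = S.
    apply/eqP; rewrite eqEfsubset -fsetD_eq0 GK0 eqxx.
    by apply/fsubsetP => j; rewrite memS => /andP[].
  exists chiK => [|u uchi j]; first by have -> : G = K by apply: group_inj.
  by rewrite {1}eGK memS => /andP[_ /asboolP->]; apply: hK.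
pose G' := Defs.Group GK0.
have memG' j : (j \in gset G') = (j \notin S) && (j \in gset G) by rewrite !inE.
have [|j|chi vchi hchi] := IH G'.
- rewrite -ltnS; apply: leq_trans ltGn; apply: fproper_ltn_card.
  rewrite fproperE fsubsetDl; apply/fsubsetPn.
  by exists i => //; rewrite memG' iS.
- by rewrite memG' => /andP[_ /cG].
exists (And chiK chi).
  have -> : G = groupU K G'.
    apply: group_inj; apply/fsetP => j; rewrite [RHS]in_fsetU memG'.
    rewrite -[j \in gset K]/(j \in S).
    by have [|//] := boolP (j \in S); rewrite memS => /andP[->].
  apply: truth_B1 => //; apply/fdisjointP => j jK.
  by rewrite memG' jK.
move=> u; rewrite truth_And => /andP[uK uchi] j jG exh.
have [jS|jS] := boolP (j \in S).
  by move: jS exh; rewrite memS => /andP[_ /asboolP->]; apply: hK.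
apply: hchi => // [|k /exh[kG ck]]; first by rewrite memG' jS.
split=> //; rewrite memG' kG andbT; move: jS.
by rewrite !memS jG kG /= ck.
Qed.

(** The member picked for [(G, phi)] is the one whose share excludes the world
    if [phi] fails there. *)
Record dissent := Dissent {
  dissenter :> box_index -> I;
  dissenter_member : forall p, dissenter p \in gset p.1
}.

Lemma dissent_inhabited : inhabited dissent.
Proof.
have [f hf] := choice (fun p : box_index => group_inhabited p.1).
by apply: inhabits; exists f.
Qed.

Notation canonical_world := (state Ax * dissent)%type.

Definition share (i : I) (p : box_index) : set canonical_world :=
  [set w : canonical_world | w.1 p.2 \/ w.2 p <> i].

Definition canonical_nbhd (i : I) (w : canonical_world) :
    set (set canonical_world) :=
  [set Y | exists p, [/\ i \in gset p.1, w.1 (Box p.1 p.2) & share i p `<=` Y]].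

Definition canonical (v0 : state Ax) : model I P :=
  @Model I P canonical_world
    (let: inhabits d := dissent_inhabited in inhabits (v0, d))
    canonical_nbhd (fun x => [set w : canonical_world | w.1 (Var x)]).

Lemma canonical_monotone v0 : monotone (canonical v0).
Proof.
move=> i w X Y [p [ip wp pX]] XY; exists p; split=> //.
exact: subset_trans XY.
Qed.

Lemma share_bigcap G phi (w : canonical_world) :
  w.1 phi <-> forall i, i \in gset G -> share i (G, phi) w.
Proof.
split=> [wphi i _|h]; first by left.
by case: (h _ (dissenter_member w.2 (G, phi))).
Qed.

(** For each index that is not exhausted, some member of its group contributes
    nothing to it. Picking such members yields one function that, paired with
    any state, lies in all contributed shares of these indices; so at that
    world only the exhausted indices constrain the state. *)
Lemma truth_Box_share v G phi (c : I -> box_index) :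
    (forall i, i \in gset G -> i \in gset (c i).1 /\ v (Box (c i).1 (c i).2)) ->
    (forall w, (forall i, i \in gset G -> share i (c i) w) -> w.1 phi) ->
  v (Box G phi).
Proof.
move=> /truth_Box_combine[chi vchi hchi] hphi.
apply: truth_Box_monotone vchi => u uchi.
have /choice[f hf] : forall p : box_index, exists i, i \in gset p.1 /\
    (~ exhausted c (gset G) p -> ~ (i \in gset G /\ c i = p)).
  move=> p.
  have [exh|] := pselect (exhausted c (gset G) p); last first.
    by move=> /existsNP[i /not_implyP[ip ni]]; exists i.
  by have [i ip] := group_inhabited p.1; exists i.
apply: (hphi (u, Dissent (fun p => (hf p).1))) => i iG.
have [exh|nexh] := pselect (exhausted c (gset G) (c i)).
  by left; apply: hchi exh.
by right=> /= fi; have [_ /(_ nexh)] := hf (c i); rewrite fi; apply.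
Qed.

Lemma canonical_truth v0 (w : world (canonical v0)) phi : sat w phi <-> w.1 phi.
Proof.
elim: phi w => [x|//|phi IH|phi IH1 psi IH2|G phi IH] w.
- by [].
- by split=> //; have [->] := truth_boolean w.1.
- by rewrite /= IH truth_Neg; split=> /negP.
- by rewrite /= IH1 IH2 truth_Or; split=> /orP.
rewrite sat_Box; split=> [[X hX eX]|wphi]; last first.
  exists (fun i => share i (G, phi)) => [i iG|u].
    by exists (G, phi); split.
  by rewrite IH; apply: share_bigcap.
have /choice[c hc] : forall i, exists p, i \in gset G ->
    [/\ i \in gset p.1, w.1 (Box p.1 p.2) & share i p `<=` X i].
  move=> i.
  have [/hX[p hp]|niG] := boolP (i \in gset G); first by exists p.
  (* Outside [G] the value of [c] is arbitrary. *)
  by exists (G, phi).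
apply: (truth_Box_share (c := c)) => [i /hc[]//|u hu].
apply/IH/eX => i iG; have [_ _] := hc i iG; apply; exact: hu.
Qed.

Lemma canonical_complete Gamma phi :
  entails (@monotone I P) Gamma phi -> derives Ax Gamma phi.
Proof.
move=> ent; apply: contrapT => /(lindenbaum tautology_theorem)[v [vGamma]].
apply/negP/negPn; have [d] := dissent_inhabited.
apply/(@canonical_truth v (v, d))/ent; first exact: canonical_monotone.
by move=> psi Gpsi; apply/canonical_truth/vGamma.
Qed.

End Canonical.

Theorem theorem6 (I : choiceType) (P : countType) (A : set (formula I P))
    (hA : cpl_axiomatization A) :
  axiomatized_by (@monotone I P) (system_B A `|` RM_schema).
Proof.
move=> Gamma phi; split; first exact: derives_sound.
apply: canonical_complete => psi; last 2 first.
- by move=> hpsi; apply: theorem_ax; left; right.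
- by move=> hpsi; apply: theorem_ax; right.
move/hA; elim=> [chi Achi|chi1 chi2 _ IH1 _ IH2].
  by apply: theorem_ax; left; left.
exact: theorem_MP IH1 IH2.
Qed.
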